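(* There is a universal constant $C>0$ such that there is no stopping rule $T$ for testing $\mathcal{D}_1=\mathcal{D}_2$ versus $\mathcal{D}_1\ne\mathcal{D}_2$ with error probability $1/16$ such that, for all distributions $\mathcal{D}_1\ne\mathcal{D}_2$ on $[n]$ with $d=\mathrm{TV}(\mathcal{D}_1,\mathcal{D}_2)$, $$\mathbb{P}\left(\tau_2(T,\mathcal{D}_1,\mathcal{D}_2)\le C\frac{n^{1/2}\log\log(1/d)^{1/2}}{d^2}\right)\ge\frac{15}{16}.$$ Similar statements hold with $\frac{n^{1/2}\log\log(1/d)^{1/2}}{d^2}$ replaced by $\frac{\log\log(1/d)}{d^2}$ or by $\frac{n^{2/3}\log\log(1/d)^{1/3}}{d^{4/3}}$.
   Context: Distributions on $[n]=\{1,\dots,n\}$, $\mathrm{TV}(\mathcal{D},\mathcal{D}')=\frac12\sum_i|\mathcal{D}_i-\mathcal{D}'_i|$. A stopping rule for closeness is $T:\bigcup_k[n]^k\times[n]^k\to\{0,1,2\}$ with $T(x,y)\ne0\Rightarrow T(xz,yw)=T(x,y)$ whenever $|x|=|y|$, $|z|=|w|$; with $x_1,\dots$ i.i.d. from $\mathcal{D}_1$ and $y_1,\dots$ i.i.d. from $\mathcal{D}_2$, $\tau_2(T,\mathcal{D}_1,\mathcal{D}_2)=\inf\{t:T(x_1\cdots x_t,y_1\cdots y_t)=2\}$, where output $2$ declares $\mathcal{D}_1\ne\mathcal{D}_2$. Testing $\mathcal{D}_1=\mathcal{D}_2$ vs $\mathcal{D}_1\ne\mathcal{D}_2$ with error probability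 $1/16$ means that, when $\mathcal{D}_1=\mathcal{D}_2$, the rule declares $\mathcal{D}_1\ne\mathcal{D}_2$ (ever) with probability at most $1/16$. *)

(* Defs.v *)
From HB Require Import structures.
From mathcomp Require Import all_boot all_order all_algebra finmap.
From mathcomp Require Import all_classical all_reals all_analysis.
Set Implicit Arguments.
Unset Strict Implicit.
Unset Printing Implicit Defensive.
Import Order.TTheory GRing.Theory Num.Theory.
Local Open Scope classical_set_scope.
Local Open Scope ring_scope.

(* Built on MathComp-Analysis. The set [n] = {1, ..., n} is rendered by 'I_n. *)

Record distr (R : realType) (n : nat) := Distr {
  distr_val :> {ffun 'I_n -> R};
  _ : [forall i, 0 <= distr_val i] && (\sum_i distr_val i == 1) }.

HB.instance Definition _ (R : realType) (n : nat) :=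
  [isSub for @distr_val R n].
HB.instance Definition _ (R : realType) (n : nat) :=
  [Equality of distr R n by <:].

Definition TV (R : realType) (n : nat) (D1 D2 : distr R n) : R :=
  2^-1 * \sum_i `|D1 i - D2 i|.

(* The values 0, 1, 2 of 'I_3 mean "continue", "declare D1 = D2" and
   "declare D1 <> D2". *)
Record stopping_rule (n : nat) := StoppingRule {
  rule :> forall k : nat, k.-tuple 'I_n -> k.-tuple 'I_n -> 'I_3;
  rule_stable : forall (k m : nat) (x y : k.-tuple 'I_n) (z w : m.-tuple 'I_n),
    rule x y <> 0%N :> nat -> rule (cat_tuple x z) (cat_tuple y w) = rule x y }.

(* Equal to +oo when the rule never outputs 2. *)
Definition tau2 (R : realType) (n : nat) (T : stopping_rule n)
    (x y : nat -> 'I_n) : \bar R :=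
  ereal_inf [set t%:R%:E | t in
    [set t : nat | T t [tuple x i | i < t] [tuple y i | i < t] = 2%N :> nat]].

Definition mutually_independent (R : realType) (d : measure_display)
    (Omega : measurableType d) (P : probability Omega R) (I : choiceType)
    (A : Type) (Z : I -> Omega -> A) : Prop :=
  forall (J : {fset I}) (B : I -> set A),
    P (\bigcap_(j in [set` J]) Z j @^-1` B j)
    = (\prod_(j <- enum_fset J) P (Z j @^-1` B j))%E.

Definition two_samples (A : Type) (X Y : nat -> A) (i : nat + nat) : A :=
  match i with inl j => X j | inr j => Y j end.

Record iid_samples (R : realType) (n : nat) (d : measure_display)
    (Omega : measurableType d) (P : probability Omega R) (D1 D2 : distr R n)
    (X Y : nat -> Omega -> 'I_n) : Prop := IidSamples {
  measurable_samples : forall i a,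
    measurable (two_samples X Y i @^-1` [set a]);
  law_X : forall i a, P (X i @^-1` [set a]) = (D1 a)%:E;
  law_Y : forall i a, P (Y i @^-1` [set a]) = (D2 a)%:E;
  independent_samples : mutually_independent P (two_samples X Y) }.

Definition has_error_probability (R : realType) (n : nat)
    (T : stopping_rule n) (delta : R) : Prop :=
  forall (D1 D2 : distr R n), D1 = D2 ->
  forall (d : measure_display) (Omega : measurableType d)
    (P : probability Omega R) (X Y : nat -> Omega -> 'I_n),
    iid_samples P D1 D2 X Y ->
    (P [set w | (tau2 R T (X ^~ w) (Y ^~ w) < +oo)%E] <= delta%:E)%E.

Definition stops_by (R : realType) (n : nat) (T : stopping_rule n)
    (D1 D2 : distr R n) (b p : R) : Prop :=
  forall (d : measure_display) (Omega : measurableType d)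
    (P : probability Omega R) (X Y : nat -> Omega -> 'I_n),
    iid_samples P D1 D2 X Y ->
    (p%:E <= P [set w | (tau2 R T (X ^~ w) (Y ^~ w) <= b%:E)%E])%E.

Definition loglog (R : realType) (d : R) : R := ln (ln d^-1).

(* loglog d is defined and positive exactly for 0 < d < 1/e. Near d = 1/e the
   rates below vanish, and there no rule can reach probability 15/16 for the
   trivial reason that it would have to stop at time 0; the cutoff d0 makes
   the bound one about d --> 0. The case d0 = 1/e is the requirement over the
   whole range of d where the rate makes sense. For n = 1 there are no two
   distinct distributions, hence the condition 2 <= n. *)
Definition closeness_lower_bound (R : realType) (rate : nat -> R -> R) : Prop :=
  exists C : R, 0 < C /\
  forall n : nat, (2 <= n)%N ->
  forall d0 : R, 0 < d0 <= expR (-1) ->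
  ~ exists T : stopping_rule n,
      has_error_probability T (1 / 16 : R) /\
      forall D1 D2 : distr R n, D1 <> D2 -> TV D1 D2 < d0 ->
        stops_by T D1 D2 (C * rate n (TV D1 D2)) (15 / 16).

(* Main.v *)
(** Since [n] is fixed while [d --> 0], each of the three rates is eventually at most
[loglog d / d^2], so only that rate matters, and two symbols suffice: compare the null
"fair coin, fair coin" with the alternative "fair coin, coin of bias [1/2 + d]". After [t]
pairs the second moment of the likelihood ratio is [(1 + 4 d^2)^t <= exp (4 d^2 t)].

Put [d_m = exp (- m^2)] and [t_m ~ loglog d_m / (8 d_m^2)]. At time [t_(m-1)] the
alternative [d_m] is still indistinguishable from the null, so a rule with error [1/16] has
rejected it with probability at most [3/8]; at time [t_m] it must have rejected it with
probability at least [15/16]. Hence under the alternative it stops in between with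
probability at least [9/16], and changing measure, it does so under the null with
probability at least [exp (- 4 d_m^2 t_m) / 4 >= 1 / (8 m)]. These events are disjoint, and
the harmonic series diverges. *)

Require Import Defs.
From HB Require Import structures.
From mathcomp Require Import all_boot all_order all_algebra finmap.
From mathcomp Require Import all_classical all_reals all_analysis.
From mathcomp Require Import measurable_realfun zify ring lra.
Import Order.TTheory GRing.Theory Num.Theory.
Local Open Scope ring_scope.

Set Implicit Arguments.
Unset Strict Implicit.

(** * Independent biased coins realized on [[0, 1)] *)

Section Coins.
Context {R : realType}.
Implicit Types (q : nat -> R) (x : R).

(** The error and stopping conditions quantify over all probability spaces; this is the one on which
    they are instantiated. A half-open interval splits into two half-open pieces, each of which
    [coin_step] maps back onto it. *)
Definition half_open_lebesgue : set (measurableTypeR R) -> \bar R :=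
  mrestr lebesgue_measure (measurable_itv `[0 : R, 1[).

HB.instance Definition _ := Measure.on half_open_lebesgue.

Lemma half_open_lebesgue_setT : half_open_lebesgue setT = 1%E.
Proof.
rewrite /half_open_lebesgue /mrestr setTI lebesgue_measure_itv /= lte_fin ltr01.
by rewrite oppr0 adde0.
Qed.

HB.instance Definition _ :=
  Measure_isProbability.Build _ _ _ half_open_lebesgue half_open_lebesgue_setT.

Definition bern (p : R) (b : bool) : R := if b then p else 1 - p.

(* A point of [0, 1) decides a coin by falling below [p] or not, and is then rescaled to
   [0, 1); the points producing a given word form an interval whose length is the
   probability of the word. *)
Definition coin_step (p x : R) : R := if x < p then x / p else (x - p) / (1 - p).

Fixpoint coin_orbit (q : nat -> R) (x : R) (i : nat) : R :=
  if i is j.+1 then coin_orbit (q \o succn) (coin_step (q 0%N) x) j else x.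

Definition coin (q : nat -> R) (i : nat) (x : R) : bool := coin_orbit q x i < q i.

Lemma coinS q i x : coin q i.+1 x = coin (q \o succn) i (coin_step (q 0%N) x).
Proof. by []. Qed.

(** Induction with [q] and [w] generalized: [coin_step p] is affine on [[0, p)] and on [[p, 1)], so
    the interval of the shifted word pulls back to one scaled by [p] or [1 - p]. *)
Lemma coin_cylinder N q (w : nat -> bool) : (forall i, 0 < q i < 1) ->
  exists a, [/\ 0 <= a, a + \prod_(i < N) bern (q i) (w i) <= 1 &
    forall x, 0 <= x < 1 ->
      (forall i, (i < N)%N -> coin q i x = w i) <->
      a <= x < a + \prod_(i < N) bern (q i) (w i)].
Proof.
elim: N q w => [|N IH] q w q01.
  exists 0; rewrite big_ord0 add0r; split=> // x x01; split=> // _; exact: x01.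
have [a [a0 a1 aP]] := IH (q \o succn) (w \o succn) (fun i => q01 i.+1).
set l := \prod_(i < N) _ in a1 aP *.
have -> : \prod_(i < N.+1) bern (q i) (w i) = bern (q 0%N) (w 0%N) * l.
  by rewrite big_ord_recl.
have q0 := q01 0%N; set p := q 0%N in q0 *.
have l0 : 0 <= l.
  apply: prodr_ge0 => i _; rewrite /bern; case: ifP => _; have := q01 i.+1; rewrite /=; lra.
have cS x : (forall i, (i < N.+1)%N -> coin q i x = w i) <->
    (coin q 0 x = w 0%N /\
     forall i, (i < N)%N -> coin (q \o succn) i (coin_step p x) = w i.+1).
  split=> [H|[H0 H] [|i] // iN]; last exact: H.
  by split=> [|i iN]; [exact: H|rewrite -coinS; exact: H].
have c0 x : coin q 0 x = (x < p) by [].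
case w0 : (w 0%N); rewrite /bern.
  exists (p * a); split; [nra|nra|] => x x01.
  rewrite cS c0 w0; split.
    move=> [xp]; rewrite /coin_step xp.
    have y01 : 0 <= x / p < 1.
      by apply/andP; split; [apply: divr_ge0; lra|rewrite ltr_pdivrMr; lra].
    move/(aP _ y01); rewrite ler_pdivlMr ?ltr_pdivrMr; [|lra|lra].
    by move=> /andP[? ?]; apply/andP; split; lra.
  move=> /andP[H1 H2]; have xp : x < p by nra.
  split=> //; rewrite /coin_step xp.
  have y01 : 0 <= x / p < 1.
    by apply/andP; split; [apply: divr_ge0; lra|rewrite ltr_pdivrMr; lra].
  apply/(aP _ y01); rewrite ler_pdivlMr ?ltr_pdivrMr; [|lra|lra].
  by apply/andP; split; lra.
exists (p + (1 - p) * a); split; [nra|nra|] => x x01.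
rewrite cS c0 w0; split.
  move=> [xp]; rewrite /coin_step xp.
  have y01 : 0 <= (x - p) / (1 - p) < 1.
    move/negbT: xp; rewrite -leNgt => xp.
    by apply/andP; split; [apply: divr_ge0; lra|rewrite ltr_pdivrMr; lra].
  move/(aP _ y01); rewrite ler_pdivlMr ?ltr_pdivrMr; [|lra|lra].
  by move=> /andP[? ?]; apply/andP; split; lra.
move=> /andP[H1 H2]; have xp : (x < p) = false by apply/negbTE; rewrite -leNgt; nra.
split=> //; rewrite /coin_step xp; move/negbT: xp; rewrite -leNgt => xp.
have y01 : 0 <= (x - p) / (1 - p) < 1.
  by apply/andP; split; [apply: divr_ge0; lra|rewrite ltr_pdivrMr; lra].
apply/(aP _ y01); rewrite ler_pdivlMr ?ltr_pdivrMr; [|lra|lra].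
by apply/andP; split; lra.
Qed.

Lemma measurable_coin_step p : measurable_fun [set: R] (coin_step p).
Proof.
apply: measurable_fun_ifT.
- by apply: measurable_fun_ltr => //; exact: measurable_cst.
- by apply: measurable_funM => //; exact: measurable_cst.
- apply: measurable_funM; last exact: measurable_cst.
  by apply: measurable_funB => //; exact: measurable_cst.
Qed.

Lemma measurable_coin q i : measurable_fun [set: R] (coin q i).
Proof.
elim: i q => [|i IH] q.
  by apply: (@measurable_fun_ltr _ _ _ _ id (cst (q 0%N))) => //; exact: measurable_cst.
exact: measurableT_comp (IH (q \o succn)) (measurable_coin_step (q 0%N)).
Qed.

Lemma measurable_coin_preimage q i (B : set bool) :
  measurable (coin q i @^-1` B : set (measurableTypeR R))%classic.
Proof. by rewrite -[X in measurable X]setTI; exact: measurable_coin. Qed.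

Lemma measurable_coin_word q N (S : pred {ffun 'I_N -> bool}) :
  measurable ([set x | S [ffun i : 'I_N => coin q i x]] : set (measurableTypeR R))%classic.
Proof.
have -> : [set x | S [ffun i : 'I_N => coin q i x]]%classic =
    (\bigcup_(w in [set w | S w])
      \bigcap_(i in [set: 'I_N]) (coin q i @^-1` [set w i]))%classic.
  apply/seteqP; split=> x /=.
    by move=> Sx; exists [ffun i : 'I_N => coin q i x] => //= i _; rewrite /= ffunE.
  move=> [w Sw wx]; rewrite (_ : [ffun i : 'I_N => _] = w) //.
  by apply/ffunP => i; rewrite ffunE; exact: wx.
apply: fin_bigcup_measurable => // w _.
by apply: fin_bigcap_measurable => // i _; exact: measurable_coin_preimage.
Qed.

Lemma half_open_lebesgue_coin_word q N (S : pred {ffun 'I_N -> bool}) :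
  (forall i, 0 < q i < 1) ->
  half_open_lebesgue [set x | S [ffun i : 'I_N => coin q i x]]%classic =
  (\sum_(w | S w) \prod_(i < N) bern (q i) (w i))%:E.
Proof.
move=> q01.
(* Including [S w] makes the cylinders of all other words empty, so the disjoint union can run over
   every word. *)
pose F w := [set x | S w && (w == [ffun i : 'I_N => coin q i x])]%classic.
have -> : [set x | S [ffun i : 'I_N => coin q i x]]%classic =
    (\bigcup_(w in [set` index_enum {ffun 'I_N -> bool}]) F w)%classic.
  apply/seteqP; split=> x /=.
    move=> Sx; exists [ffun i : 'I_N => coin q i x]; first exact: mem_index_enum.
    by rewrite /F /= Sx eqxx.
  by move=> [w _ /andP[Sw /eqP <-]].
rewrite measure_fin_bigcup; first last.
- by move=> w _; exact: (measurable_coin_word q (fun v => S w && (w == v))).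
- by move=> v w _ _ [x [/andP[_ /eqP ->] /andP[_ /eqP ->]]].
- exact: finite_finset.
rewrite -fsbig_seq ?index_enum_uniq // [in RHS]big_mkcond -sumEFin; apply: eq_bigr => w _.
case: ifP => Sw; last first.
  by rewrite /F Sw (_ : [set x | _ && _]%classic = set0) ?measure0 //; apply/seteqP; split.
pose wn i := if insub i is Some j then w j else false.
have wnE (i : 'I_N) : wn i = w i by rewrite /wn valK.
have [a [a0 a1 aP]] := coin_cylinder N wn q01.
have pE : \prod_(i < N) bern (q i) (wn i) = \prod_(i < N) bern (q i) (w i).
  by apply: eq_bigr => i _; rewrite wnE.
rewrite pE in a1 aP; set l := \prod_(i < N) _ in a1 aP *.
rewrite /= /half_open_lebesgue /mrestr.
rewrite [X in lebesgue_measure X](_ : _ = `[a, a + l[%classic); last first.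
  apply/seteqP; split=> x /=; rewrite !in_itv /=.
    move=> [/andP[_ /eqP wE] x01]; apply/(aP _ x01) => i iN.
    by rewrite (wnE (Ordinal iN)) wE ffunE.
  move=> xal; have x01 : 0 <= x < 1 by lra.
  split=> //; rewrite /F /= Sw; apply/eqP/ffunP => i; rewrite ffunE.
  by have/(aP _ x01)/(_ i (ltn_ord i)) := xal; rewrite wnE.
rewrite lebesgue_measure_itv /= lte_fin.
(* The length formula tests whether the endpoints are strictly ordered; otherwise [l <= 0], and then
   [l = 0]. *)
case: ifPn => [_|]; first by rewrite -EFinB addrC addKr.
have l0 : 0 <= l.
  by apply: prodr_ge0 => i _; rewrite /bern; case: ifP => _; have := q01 i; lra.
by rewrite -leNgt => ?; congr (_%:E); lra.
Qed.
Lemma sum_bern p : \sum_b bern p b = 1.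
Proof. by rewrite /index_enum big_bool /= /bern; lra. Qed.

(** The words allowed by such a product event form a [family]; distributing the product over the
    sums turns the right-hand side into the sum of their weights. *)
Lemma half_open_lebesgue_coins q N (C : nat -> pred bool) :
  (forall i, 0 < q i < 1) ->
  half_open_lebesgue [set x | forall i, (i < N)%N -> C i (coin q i x)]%classic =
  (\prod_(i < N) \sum_(b | C i b) bern (q i) b)%:E.
Proof.
move=> q01; rewrite (bigA_distr_big_dep (fun i : 'I_N => C i)).
rewrite -(half_open_lebesgue_coin_word (fun w => w \in family (fun i : 'I_N => C i))) //.
congr (half_open_lebesgue _); apply/seteqP; split=> x /= H.
  by apply/familyP => i; rewrite ffunE; exact: H.
by move=> i iN; have /familyP/(_ (Ordinal iN)) := H; rewrite ffunE.
Qed.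

Lemma half_open_lebesgue_coin q i (B : set bool) : (forall i, 0 < q i < 1) ->
  half_open_lebesgue (coin q i @^-1` B)%classic = (\sum_(b | `[< B b >]) bern (q i) b)%:E.
Proof.
move=> q01.
pose C k : pred bool := if k == i then (fun b => `[< B b >]) else predT.
have -> : (coin q i @^-1` B)%classic =
    [set x | forall k, (k < i.+1)%N -> C k (coin q k x)]%classic.
  apply/seteqP; split=> x /=.
    by move=> Bx k _; rewrite /C; case: eqP => // ->; apply/asboolP.
  by move/(_ i (ltnSn i)); rewrite /C eqxx => /asboolP.
rewrite half_open_lebesgue_coins // big_ord_recr /= {2}/C eqxx big1 ?mul1r // => k _.
by rewrite /C ltn_eqF // sum_bern.
Qed.

Lemma coins_mutually_independent (I : choiceType) (A : Type) (idx : I -> nat)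
    (g : bool -> A) q : (forall i, 0 < q i < 1) -> injective idx ->
  mutually_independent half_open_lebesgue (fun j x => g (coin q (idx j) x)).
Proof.
move=> q01 idxI J B.
(* All constraints on toss [i]: by injectivity of [idx] at most one [j] contributes, and a toss with
   none is free and gives a factor 1. *)
pose C i : pred bool := fun b =>
  all (fun j => (idx j == i) ==> `[< B j (g b) >]) (enum_fset J).
pose N := (\max_(j <- enum_fset J) idx j).+1.
have idxN j : j \in enum_fset J -> (idx j < N)%N by move=> jJ; exact: leq_bigmax_seq.
have CJ j b : j \in enum_fset J -> C (idx j) b = `[< B j (g b) >].
  move=> jJ; apply/allP/idP => [/(_ j jJ)|Bj k kJ]; first by rewrite eqxx.
  by apply/implyP => /eqP/idxI ->.
transitivity (half_open_lebesgue [set x | forall i, (i < N)%N -> C i (coin q i x)]%classic).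
  congr (half_open_lebesgue _); apply/seteqP; split=> x /= H.
    move=> i iN; apply/allP => j jJ; apply/implyP => /eqP ji.
    by apply/asboolP; rewrite -ji; exact: H.
  by move=> j jJ; have := H _ (idxN j jJ); rewrite CJ // => /asboolP.
rewrite half_open_lebesgue_coins //.
transitivity (\prod_(j <- enum_fset J) (\sum_(b | C (idx j) b) bern (q (idx j)) b)%:E)%E; last first.
  rewrite big_seq [RHS]big_seq; apply: eq_bigr => j jJ.
  apply/esym; apply: etrans (half_open_lebesgue_coin (idx j) (fun b => B j (g b)) q01) _.
  by congr (_%:E); apply: eq_bigl => b; rewrite CJ.
rewrite prodEFin; congr (_%:E).
rewrite -(big_map idx predT (fun i => \sum_(b | C i b) bern (q i) b)) /=.
rewrite -(big_mkord predT (fun i => \sum_(b | C i b) bern (q i) b)).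
rewrite (bigID (fun i => i \in map idx (enum_fset J))) /= [X in _ * X]big1 ?mulr1; last first.
  move=> i iJ; rewrite -[RHS](sum_bern (q i)); apply: eq_bigl => b.
  apply/allP => j jJ; apply/implyP => /eqP ji; case/negP: iJ.
  by rewrite -ji map_f.
rewrite -big_filter; apply: perm_big; apply: uniq_perm.
- by rewrite filter_uniq // iota_uniq.
- by rewrite map_inj_uniq // fset_uniq.
move=> i; rewrite mem_filter mem_index_iota /= andbC.
by case: (boolP (i \in map _ _)) => [/mapP[j jJ ->]|]; rewrite ?andbF // idxN.
Qed.

Lemma coin_distr n (g : bool -> 'I_n) (p : R) : 0 <= p <= 1 ->
  exists D : distr R n, forall a, D a = \sum_(b | g b == a) bern p b.
Proof.
move=> p01; suff H : [forall i, 0 <= [ffun a => \sum_(b | g b == a) bern p b] i] &&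
    (\sum_i [ffun a => \sum_(b | g b == a) bern p b] i == 1).
  by exists (Distr H) => a; rewrite /= ffunE.
apply/andP; split.
  apply/forallP => a; rewrite ffunE; apply: sumr_ge0 => b _; rewrite /bern.
  by case: ifP; lra.
apply/eqP; under eq_bigr do rewrite ffunE.
by rewrite -[RHS](sum_bern p) [RHS](partition_big g predT).
Qed.

Lemma TV_coin_distr n (g : bool -> 'I_n) (p1 p2 : R) (D1 D2 : distr R n) :
  injective g ->
  (forall a, D1 a = \sum_(b | g b == a) bern p1 b) ->
  (forall a, D2 a = \sum_(b | g b == a) bern p2 b) ->
  TV D1 D2 = `|p1 - p2|.
Proof.
move=> gI D1E D2E; rewrite /TV.
have -> : \sum_i `|D1 i - D2 i| = \sum_b `|bern p1 b - bern p2 b|.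
  rewrite [RHS](partition_big g predT) //=; apply: eq_bigr => a _.
  rewrite D1E D2E; case: (pickP (fun b => g b == a)) => [b /eqP ba|H].
    have ga : (fun c => g c == a) =1 pred1 b by move=> c /=; rewrite -ba (inj_eq gI).
    by rewrite !(big_pred1 b).
  by rewrite !big_pred0 // subrr normr0.
rewrite big_bool /= /bern.
have -> : 1 - p1 - (1 - p2) = - (p1 - p2) by ring.
by rewrite normrN; lra.
Qed.

(* The even tosses are used for the first sample, the odd ones for the second. *)
Definition two_coins (p1 p2 : R) (i : nat) : R := if odd i then p2 else p1.

Lemma coin_iid_samples n (g : bool -> 'I_n) (p1 p2 : R) (D1 D2 : distr R n) :
  0 < p1 < 1 -> 0 < p2 < 1 ->
  (forall a, D1 a = \sum_(b | g b == a) bern p1 b) ->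
  (forall a, D2 a = \sum_(b | g b == a) bern p2 b) ->
  iid_samples half_open_lebesgue D1 D2
    (fun i x => g (coin (two_coins p1 p2) i.*2 x))
    (fun i x => g (coin (two_coins p1 p2) i.*2.+1 x)).
Proof.
move=> p1P p2P D1E D2E; set q := two_coins p1 p2.
have q01 i : 0 < q i < 1 by rewrite /q /two_coins; case: ifP.
have law i a : half_open_lebesgue ((fun x => g (coin q i x)) @^-1` [set a])%classic =
    (\sum_(b | g b == a) bern (q i) b)%:E.
  rewrite -[X in half_open_lebesgue X]/(coin q i @^-1` [set b | g b = a])%classic.
  rewrite half_open_lebesgue_coin //; congr (_%:E); apply: eq_bigl => b.
  by apply/asboolP/eqP.
split.
- move=> [i|i] a /=; exact: (measurable_coin_preimage _ _ [set b | g b = a]%classic).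
- by move=> i a; apply: etrans (law _ _) _; rewrite D1E /q /two_coins odd_double.
- by move=> i a; apply: etrans (law _ _) _; rewrite D2E /q /two_coins oddS odd_double.
have -> : two_samples (fun i x => g (coin q i.*2 x)) (fun i x => g (coin q i.*2.+1 x)) =
    (fun j x => g (coin q (match j with inl i => i.*2 | inr i => i.*2.+1 end) x)).
  by apply/funext => -[].
by apply: coins_mutually_independent => // -[i|i] [j|j] /= H;
  [congr inl; lia|lia|lia|congr inr; lia].
Qed.

End Coins.

(** * Events of finitely many tosses and change of measure *)

Section PrefixEvents.
Context {R : realType}.
Implicit Types (q : nat -> R) (E F : pred (nat -> bool)).

(** Events of the filtration generated by the tosses; since they depend on a word of length [N],
    their probabilities are finite sums. *)
Definition prefix_event (N : nat) E : Prop :=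
  forall u v : nat -> bool, (forall i, (i < N)%N -> u i = v i) -> E u = E v.

Definition coin_prob q E : R := fine (half_open_lebesgue [set x | E (coin q ^~ x)]%classic).

Definition extend_word N (w : {ffun 'I_N -> bool}) (i : nat) : bool :=
  if insub i is Some j then w j else false.

Lemma prefix_event_word N E q : prefix_event N E ->
  [set x | E (coin q ^~ x)]%classic =
  [set x | E (extend_word [ffun i : 'I_N => coin q i x])]%classic.
Proof.
move=> EN; apply: eq_set => x; congr is_true; apply: EN => i iN.
by rewrite /extend_word insubT ffunE.
Qed.

Lemma measurable_prefix_event N E q : prefix_event N E ->
  measurable ([set x | E (coin q ^~ x)] : set (measurableTypeR R))%classic.
Proof.
by move=> EN; rewrite (prefix_event_word q EN); exact: (measurable_coin_word q (E \o @extend_word N)).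
Qed.

Lemma coin_prob_sum N E q : (forall i, 0 < q i < 1) -> prefix_event N E ->
  coin_prob q E = \sum_(w | E (@extend_word N w)) \prod_(i < N) bern (q i) (w i).
Proof.
move=> q01 EN; rewrite /coin_prob (prefix_event_word q EN).
by rewrite (half_open_lebesgue_coin_word (E \o @extend_word N)).
Qed.

Lemma coin_probE N E q : (forall i, 0 < q i < 1) -> prefix_event N E ->
  half_open_lebesgue [set x | E (coin q ^~ x)]%classic = (coin_prob q E)%:E.
Proof.
move=> q01 EN; rewrite /coin_prob (prefix_event_word q EN).
by rewrite (half_open_lebesgue_coin_word (E \o @extend_word N)).
Qed.

Lemma bern_gt0 (p : R) b : 0 < p < 1 -> 0 < bern p b.
Proof. by rewrite /bern; case: b; lra. Qed.

Lemma coin_prob_setD N E F q : (forall i, 0 < q i < 1) ->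
  prefix_event N E -> prefix_event N F -> (forall u, E u -> F u) ->
  coin_prob q F = coin_prob q E + coin_prob q (fun u => F u && ~~ E u).
Proof.
move=> q01 EN FN EF; rewrite !(@coin_prob_sum N) //; last first.
  by move=> u v uv; rewrite (EN u v) // (FN u v).
rewrite (bigID (fun w => E (extend_word w))) /=; congr (_ + _).
by apply: eq_bigl => w; rewrite andb_idl //; exact: EF.
Qed.

(* AM-GM applied to each word: [2 P' <= c P + P'^2 / (c P)]; the sum of [P'^2 / P] over
   all words factorizes over the coordinates. *)
Lemma change_of_measure N E q q' (c : R) :
  (forall i, 0 < q i < 1) -> (forall i, 0 < q' i < 1) -> prefix_event N E -> 0 < c ->
  2 * coin_prob q' E <= c * coin_prob q E +
    c^-1 * \prod_(i < N) \sum_b bern (q' i) b ^+ 2 / bern (q i) b.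
Proof.
move=> q01 q'01 EN c0; rewrite !(@coin_prob_sum N) // bigA_distr_bigA /= !mulr_sumr.
pose W q (w : {ffun 'I_N -> bool}) := \prod_(i < N) bern (q i) (w i).
have W0 p w : (forall i, 0 < p i < 1) -> 0 < W p w.
  by move=> p01; apply: prodr_gt0 => i _; exact: bern_gt0.
have -> : \sum_(w : {ffun 'I_N -> bool})
      c^-1 * \prod_(i < N) (bern (q' i) (w i) ^+ 2 / bern (q i) (w i)) =
    \sum_w c^-1 * (W q' w ^+ 2 / W q w).
  apply: eq_bigr => w _; congr (_ * _).
  by rewrite big_split /= prodrXl prodfV.
rewrite [X in _ <= _ + X](bigID (fun w => E (extend_word w))) /= addrA -big_split /=.
apply: le_trans (_ : _ <= \sum_(w | E (@extend_word N w))
   (c * W q w + c^-1 * (W q' w ^+ 2 / W q w))) _; last first.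
  rewrite lerDl; apply: sumr_ge0 => w _.
  by rewrite mulr_ge0 ?invr_ge0 ?divr_ge0 ?sqr_ge0 ?ltW ?W0.
apply: ler_sum => w _; rewrite -/(W q' w).
have := W0 _ w q01; have := W0 _ w q'01; move: (W q w) (W q' w) => a b b0 a0.
rewrite -subr_ge0.
have -> : c * a + c^-1 * (b ^+ 2 / a) - 2 * b = (c * a - b) ^+ 2 / (c * a).
  by field; rewrite !gt_eqF.
by rewrite divr_ge0 ?sqr_ge0 // mulr_ge0 // ltW.
Qed.

Lemma two_coins_itv (p1 p2 : R) i :
  0 < p1 < 1 -> 0 < p2 < 1 -> 0 < two_coins p1 p2 i < 1.
Proof. by rewrite /two_coins; case: ifP. Qed.

(** Even tosses have the same law on both sides and contribute 1; each odd toss contributes [2 ((1/2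
    + e)^2 + (1/2 - e)^2) = 1 + 4 e^2]. *)
Lemma chi_square_two_coins (e : R) t :
  \prod_(i < t.*2) \sum_b bern (two_coins (1 / 2) (1 / 2 + e) i) b ^+ 2 /
    bern (two_coins (1 / 2) (1 / 2) i) b = (1 + 4 * e ^+ 2) ^+ t.
Proof.
elim: t => [|t IH]; first by rewrite big_ord0 expr0.
rewrite doubleS !big_ord_recr /= IH [RHS]exprSr -[LHS]mulrA; congr (_ * _).
rewrite !big_bool /two_coins /= odd_double /= /bern.
by have -> : (1 - 1 / 2 : R) = 1 / 2; [field|field].
Qed.

Lemma change_of_measure_two_coins E (e c : R) t :
  - (1 / 2) < e < 1 / 2 -> prefix_event t.*2 E -> 0 < c ->
  2 * coin_prob (two_coins (1 / 2) (1 / 2 + e)) E <=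
    c * coin_prob (two_coins (1 / 2) (1 / 2)) E + c^-1 * expR (4 * e ^+ 2 * t%:R).
Proof.
move=> e12 Et c0.
have p01 i : 0 < two_coins (1 / 2 : R) (1 / 2) i < 1 by apply: two_coins_itv; lra.
have q01 i : 0 < two_coins (1 / 2) (1 / 2 + e) i < 1 by apply: two_coins_itv; lra.
apply: le_trans (change_of_measure p01 q01 Et c0) _.
rewrite lerD2l ler_wpM2l ?invr_ge0 ?(ltW c0) // chi_square_two_coins.
rewrite expRM_natr lerXn2r ?nnegrE ?expR_ge0 ?expR_ge1Dx //.
by have := sqr_ge0 e; lra.
Qed.

(** Meant for rejection by an earlier and a later time. Under the alternative [F] minus [E] has mass
    at least [15/16 - 3/8 = 9/16], and a second change of measure carries this back to the null. *)
Lemma new_mass_lower_bound E F (e : R) s t :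
  0 < e < 1 / 2 -> prefix_event s.*2 E -> prefix_event t.*2 F -> (s <= t)%N ->
  (forall u, E u -> F u) ->
  4 * e ^+ 2 * s%:R <= 1 / 2 ->
  coin_prob (two_coins (1 / 2) (1 / 2)) E <= 1 / 16 ->
  15 / 16 <= coin_prob (two_coins (1 / 2) (1 / 2 + e)) F ->
  1 / 4 * expR (- (4 * e ^+ 2 * t%:R)) <=
    coin_prob (two_coins (1 / 2) (1 / 2)) F - coin_prob (two_coins (1 / 2) (1 / 2)) E.
Proof.
move=> e12 Es Ft st EF es E16 F16.
have Et : prefix_event t.*2 E by move=> u v uv; apply: Es => i i_s; apply: uv; lia.
have p01 i : 0 < two_coins (1 / 2 : R) (1 / 2) i < 1 by apply: two_coins_itv; lra.
have q01 i : 0 < two_coins (1 / 2) (1 / 2 + e) i < 1 by apply: two_coins_itv; lra.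
pose G := fun u => F u && ~~ E u.
have Gt : prefix_event t.*2 G by move=> u v uv; rewrite /G (Et u v) // (Ft u v).
have eh : - (1 / 2) < e < 1 / 2 by lra.
have expR12 : expR (1 / 2 : R) <= 2.
  have h0 := expR_gt0 (1 / 2 : R).
  have := expR_ge1Dx (- (1 / 2) : R); rewrite expRN -(ler_pM2l h0) divff ?gt_eqF //; lra.
have E38 : coin_prob (two_coins (1 / 2) (1 / 2 + e)) E <= 3 / 8.
  (* With [c = 8], twice the alternative mass of [E] is at most [8/16 + 2/8 = 3/4]. *)
  have c8 : 0 < 8 :> R by lra.
  have := change_of_measure_two_coins eh Es c8.
  have : expR (4 * e ^+ 2 * s%:R) <= 2 by apply: le_trans expR12; rewrite ler_expR.
  lra.
have := coin_prob_setD q01 Et Ft EF; have := coin_prob_setD p01 Et Ft EF.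
rewrite -/G => pF qF.
set M := expR (4 * e ^+ 2 * t%:R); have M0 : 0 < M by exact: expR_gt0.
(* With [c = 2 * M] the second-moment term becomes [1/2], so [9/8 <= 2 M P(G) + 1/2] and
   [P(G) >= 5 / (16 M)] under the null. *)
have c0 : 0 < 2 * M by rewrite mulr_gt0.
have := change_of_measure_two_coins eh Gt c0; rewrite -/M.
have -> : (2 * M)^-1 * M = 1 / 2 by field; rewrite gt_eqF.
move=> H; rewrite expRN -/M pF.
have -> : forall a b : R, a + b - a = b by move=> a b; ring.
rewrite -(ler_pM2l M0) mulrCA divff ?gt_eqF //; lra.
Qed.

End PrefixEvents.

(** * Rejection by a stopping rule as an event of the tosses *)

Section RuleEvents.
Context {R : realType}.
Variables (n : nat) (T : stopping_rule n) (g : bool -> 'I_n).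

Definition rejects_by (t : nat) (u : nat -> bool) : bool :=
  T t [tuple g (u i.*2) | i < t] [tuple g (u i.*2.+1) | i < t] == 2%N :> nat.

Lemma prefix_event_rejects_by t : prefix_event t.*2 (rejects_by t).
Proof.
move=> u v uv; rewrite /rejects_by; congr (_ == _); congr (nat_of_ord (T _ _ _)).
all: by apply: eq_from_tnth => i; rewrite !tnth_mktuple uv //; have := ltn_ord i; lia.
Qed.

Lemma rejects_by_mono s t u : (s <= t)%N -> rejects_by s u -> rejects_by t u.
Proof.
move=> st; rewrite -(subnKC st); move: (t - s)%N => m /eqP Ts.
have stopped := rule_stable [tuple g (u (s + i).*2) | i < m] [tuple g (u (s + i).*2.+1) | i < m].
have catE (v : nat -> 'I_n) : [tuple v i | i < s + m] =
    cat_tuple [tuple v i | i < s] [tuple v (s + i)%N | i < m].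
  apply: eq_from_tnth => i; rewrite tnth_mktuple.
  by case: (split_ordP i) => j ->; rewrite ?tnth_lshift ?tnth_rshift tnth_mktuple.
rewrite /rejects_by (catE (fun i => g (u i.*2))) (catE (fun i => g (u i.*2.+1))).
by rewrite stopped Ts.
Qed.

(** A strict bound yields a witness from the infimum without showing that it is attained; [b = +oo]
    covers the event of ever rejecting. *)
Lemma tau2_lt_rejects_by (q : nat -> R) (x : R) (b : \bar R) :
  (tau2 R T (fun i => g (coin q i.*2 x)) (fun i => g (coin q i.*2.+1 x)) < b)%E <->
  exists2 t, (t%:R%:E < b)%E & rejects_by t (coin q ^~ x).
Proof.
split=> [/ereal_inf_lt[_ [t /= Tt <-] tb]|[t tb /eqP Tt]]; first by exists t => //; apply/eqP.
by apply: le_lt_trans tb; apply: ereal_inf_lbound; exists t.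
Qed.

Lemma reject_prob_null (p : R) t : 0 < p < 1 ->
  has_error_probability T (1 / 16 : R) ->
  coin_prob (two_coins p p) (rejects_by t) <= 1 / 16.
Proof.
move=> p01 err; have p01' : 0 <= p <= 1 by lra.
have [D DE] := coin_distr g p01'.
have q01 i : 0 < two_coins p p i < 1 by exact: two_coins_itv.
have := err D D erefl _ _ _ _ _ (coin_iid_samples p01 p01 DE DE).
rewrite -lee_fin -(coin_probE q01 (@prefix_event_rejects_by t)).
apply: le_trans; apply: le_measure; rewrite ?inE.
- exact: measurable_prefix_event (@prefix_event_rejects_by t).
(* Ever rejecting is a countable union of prefix events, hence measurable. *)
- rewrite (_ : [set _ | _] = \bigcup_s [set x | rejects_by s (coin (two_coins p p) ^~ x)])%classic.
    apply: bigcup_measurable => s _; exact: measurable_prefix_event (@prefix_event_rejects_by s).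
  apply/seteqP; split=> x /=; first by move=> /tau2_lt_rejects_by[s _ xs]; exists s.
  by move=> [s _ xs]; apply/tau2_lt_rejects_by; exists s => //; exact: ltry.
- by move=> x /= xt; apply/tau2_lt_rejects_by; exists t => //; exact: ltry.
Qed.

Lemma reject_prob_alternative (p1 p2 b r : R) (D1 D2 : distr R n) t :
  0 < p1 < 1 -> 0 < p2 < 1 ->
  (forall a, D1 a = \sum_(c | g c == a) bern p1 c) ->
  (forall a, D2 a = \sum_(c | g c == a) bern p2 c) ->
  0 <= b -> b <= t%:R -> stops_by T D1 D2 b r ->
  r <= coin_prob (two_coins p1 p2) (rejects_by t).
Proof.
move=> p1P p2P D1E D2E b0 bt stops.
have q01 i : 0 < two_coins p1 p2 i < 1 by exact: two_coins_itv.
have := stops _ _ _ _ _ (coin_iid_samples p1P p2P D1E D2E).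
rewrite -lee_fin -(coin_probE q01 (@prefix_event_rejects_by t)).
move=> /le_trans; apply.
have /andP[b1 b2] := truncn_itv b0.
(* Rejection times are integers, so stopping by [b] means stopping strictly before
   [Num.truncn b + 1], that is, having rejected by [Num.truncn b]. *)
have -> : [set x | (tau2 R T (fun i => g (coin (two_coins p1 p2) i.*2 x))
    (fun i => g (coin (two_coins p1 p2) i.*2.+1 x)) <= b%:E)%E]%classic =
  [set x | rejects_by (Num.truncn b) (coin (two_coins p1 p2) ^~ x)]%classic.
  apply/seteqP; split=> x /=.
    move=> tb; have : (tau2 R T (fun i => g (coin (two_coins p1 p2) i.*2 x))
      (fun i => g (coin (two_coins p1 p2) i.*2.+1 x)) < (Num.truncn b).+1%:R%:E)%E.
      by apply: le_lt_trans tb _; rewrite lte_fin.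
    move=> /tau2_lt_rejects_by[s]; rewrite lte_fin ltr_nat ltnS; exact: rejects_by_mono.
  move=> /eqP xb; apply: (@le_trans _ _ (Num.truncn b)%:R%:E).
    by apply: ereal_inf_lbound; exists (Num.truncn b).
  by rewrite lee_fin.
apply: le_measure; rewrite ?inE.
- exact: measurable_prefix_event (@prefix_event_rejects_by _).
- exact: measurable_prefix_event (@prefix_event_rejects_by _).
- move=> x /=; apply: rejects_by_mono.
  by rewrite -(ler_nat R); exact: le_trans bt.
Qed.

End RuleEvents.

(** * The scales of the alternative and their times *)

Section Scales.
Context {R : realType}.
Implicit Types m : nat.

(* Then [loglog (scale m) = 2 ln m], which makes [4 * scale m ^+ 2 * scale_time m] essentially
   [ln m] for the constant [C = 1 / 8]. *)
Definition scale m : R := expR (- m%:R ^+ 2).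

(** The successor rounds up, so that this integer time is past the real bound required of the
    rule. *)
Definition scale_time m : nat := (Num.truncn (ln m%:R / 4 * expR (2 * m%:R ^+ 2) : R)).+1.

Lemma scale_sqr m : scale m ^+ 2 = expR (- (2 * m%:R ^+ 2)).
Proof. by rewrite /scale -expRM_natl mulrN. Qed.

Lemma loglog_scale m : (1 < m)%N ->
  1 / 8 * (loglog (scale m) / scale m ^+ 2) = ln m%:R / 4 * expR (2 * m%:R ^+ 2).
Proof.
move=> m1; have m0 : 0 < m%:R :> R by rewrite ltr0n; lia.
rewrite scale_sqr /loglog /scale -expRN opprK expRK lnXn // expRN invrK; field => //.
Qed.

Lemma expRN_le_inv (x : R) : 0 <= x -> expR (- x) <= (1 + x)^-1.
Proof. by move=> x0; rewrite expRN lef_pV2 ?posrE ?expR_gt0 ?expR_ge1Dx //; lra. Qed.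

Lemma ln_le_self (x : R) : 0 < x -> ln x <= x.
Proof. by move=> x0; have := expR_ge1Dx (ln x); rewrite lnK ?posrE //; lra. Qed.

Lemma scale_time_bound m : (1 < m)%N ->
  ln m%:R / 4 * expR (2 * m%:R ^+ 2) <= ((scale_time m)%:R : R)
    <= ln m%:R / 4 * expR (2 * m%:R ^+ 2) + 1.
Proof.
move=> m1; have y0 : 0 <= ln m%:R / 4 * expR (2 * m%:R ^+ 2) :> R.
  by rewrite !mulr_ge0 ?expR_ge0 ?ln_ge0 // ler1n; lia.
have /andP[H1 H2] := truncn_itv y0.
by rewrite /scale_time (ltW H2) /= -natr1 lerD2r.
Qed.

Lemma scale_time_mono m : (1 < m)%N -> (scale_time m <= scale_time m.+1)%N.
Proof.
move=> m1; rewrite ltnS; apply: le_truncn.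
have m0 : 1 < m%:R :> R by rewrite ltr1n.
apply: ler_pM; rewrite ?expR_ge0 ?mulr_ge0 ?ln_ge0 ?(ltW m0) //.
  by rewrite ler_wpM2r // ler_ln ?posrE ?ler_nat // ltr0n; lia.
by rewrite ler_expR ler_pM2l // lerXn2r ?nnegrE ?ler0n // ler_nat.
Qed.

Lemma scale_le_inv m : (0 < m)%N -> scale m <= m%:R^-1.
Proof.
move=> m0; have m1 : 1 <= m%:R :> R by rewrite ler1n.
apply: le_trans (expRN_le_inv (sqr_ge0 _)) _.
by rewrite lef_pV2 ?posrE; nra.
Qed.

(** Controls the error from rounding up: one extra unit of time adds [4 * scale m ^+ 2] to the
    exponent. *)
Lemma scale_sqr_le m : (3 < m)%N -> 4 * scale m ^+ 2 <= 1 / 4.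
Proof.
move=> m3; have m4 : 4 <= m%:R :> R by rewrite ler_nat.
have x0 : 0 <= 2 * m%:R ^+ 2 :> R by nra.
rewrite scale_sqr; have := expRN_le_inv x0.
have : (1 + 2 * m%:R ^+ 2 : R)^-1 <= 16^-1 by rewrite lef_pV2 ?posrE; nra.
lra.
Qed.

(** The gap [2 (m + 1)^2 - 2 m^2 = 4 m + 2] between exponents absorbs the factor [ln m]: the main
    term is at most [m / (4 m + 3)], below [1/4], and rounding costs another [1/4]. *)
Lemma scale_next_time m : (3 < m)%N ->
  4 * scale m.+1 ^+ 2 * (scale_time m)%:R <= 1 / 2.
Proof.
move=> m3; have m4 : 4 <= m%:R :> R by rewrite ler_nat.
have m1 : (1 < m)%N by lia.
have /andP[_ tm] := scale_time_bound m1.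
have s4 : 4 * scale m.+1 ^+ 2 <= 1 / 4 by apply: scale_sqr_le; lia.
have s0 : 0 <= 4 * scale m.+1 ^+ 2 by rewrite mulr_ge0 // sqr_ge0.
apply: le_trans (ler_wpM2l s0 tm) _; rewrite mulrDr mulr1.
suff : 4 * scale m.+1 ^+ 2 * (ln m%:R / 4 * expR (2 * m%:R ^+ 2)) <= 1 / 4 by lra.
have -> : 4 * scale m.+1 ^+ 2 * (ln m%:R / 4 * expR (2 * m%:R ^+ 2)) =
    ln m%:R * expR (- (4 * m%:R + 2)).
  have -> : - (4 * m%:R + 2) = - (2 * m.+1%:R ^+ 2) + 2 * m%:R ^+ 2 :> R.
    by rewrite -natr1; ring.
  by rewrite expRD scale_sqr; field.
have l0 : 0 <= ln m%:R :> R by rewrite ln_ge0; lra.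
have lm : ln m%:R <= m%:R :> R by by apply: ln_le_self; lra.
have x0 : 0 <= 4 * m%:R + 2 :> R by lra.
apply: le_trans (ler_pM l0 (expR_ge0 _) lm (expRN_le_inv x0)) _.
by rewrite ler_pdivrMr; lra.
Qed.

(** The exponent is at most [ln m + 1/2] including rounding, and [expR (- (1 / 2)) >= 1/2]. *)
Lemma scale_time_mass m : (3 < m)%N ->
  1 / 2 / m%:R <= expR (- (4 * scale m ^+ 2 * (scale_time m)%:R)).
Proof.
move=> m3; have m0 : 0 < m%:R :> R by rewrite ltr0n; lia.
have m1 : (1 < m)%N by lia.
have /andP[_ tm] := scale_time_bound m1.
have s4 := scale_sqr_le m3.
have s0 : 0 <= 4 * scale m ^+ 2 by rewrite mulr_ge0 // sqr_ge0.
have tl : 4 * scale m ^+ 2 * (scale_time m)%:R <= ln m%:R + 1 / 2.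
  apply: le_trans (ler_wpM2l s0 tm) _; rewrite mulrDr mulr1.
  have -> : 4 * scale m ^+ 2 * (ln m%:R / 4 * expR (2 * m%:R ^+ 2)) = ln m%:R.
    rewrite scale_sqr expRN; field; exact/lt0r_neq0/expR_gt0.
  lra.
apply: (@le_trans _ _ (expR (- (ln m%:R + 1 / 2)))); last by rewrite ler_expR lerN2.
rewrite opprD expRD expRN lnK ?posrE // mulrC ler_wpM2l ?invr_ge0 ?(ltW m0) //.
by have := expR_ge1Dx (- (1 / 2) : R); lra.
Qed.

End Scales.

(** * Divergence of the harmonic series and the [loglog] lower bound *)

(** Telescoping from [K] would bound the nondecreasing partial sums of the harmonic series, which
    would then converge. *)
Lemma harmonic_increments_unbounded (R : realType) (f : nat -> R) (c B : R) (K : nat) :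
  0 < c -> (forall m, f m <= B) ->
  ~ (forall m, (K <= m)%N -> c / m.+1%:R <= f m.+1 - f m).
Proof.
move=> c0 fB H; apply: (@dvg_harmonic R).
have inc : {homo series (@harmonic R) : i j / (i <= j)%N >-> i <= j}.
  by apply: nondecreasing_series => i _ _; rewrite /= invr_ge0.
have bd j : c * (series harmonic (K + j)%N - series harmonic K) <= f (K + j)%N - f K.
  elim: j => [|j IH]; first by rewrite addn0; lra.
  have := H (K + j)%N (leq_addr _ _).
  (* [harmonic i] is [1 / (i + 1)], so the new term matches the increment from [K + j]. *)
  rewrite addnS seriesSr /= addrAC mulrDr => Hj.
  by rewrite -(subrK (f (K + j)%N) (f (K + j).+1)) -addrA [leRHS]addrC; exact: lerD.
apply: nondecreasing_is_cvgn => //.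
exists (series harmonic K + (B - f K) / c) => _ [j _ <-].
apply: le_trans (inc _ _ (leq_addl K j)) _.
rewrite -lerBlDl ler_pdivlMr // mulrC; apply: le_trans (bd j) _.
by rewrite lerD2r.
Qed.

(** The threshold [d1] may depend on [n]: only scales with large [m] are examined, so the constant
    stays uniform in [n]. *)
Lemma closeness_lower_bound_loglog (R : realType) (rate : nat -> R -> R) :
  (forall n, (2 <= n)%N -> exists2 d1 : R, 0 < d1 &
     forall d, 0 < d < d1 -> 0 <= rate n d <= loglog d / d ^+ 2) ->
  closeness_lower_bound rate.
Proof.
(* This constant keeps the exponent near [ln m], so the null mass gained at scale [m] is at least a
   multiple of [1 / m]. *)
move=> rateP; exists (1 / 8); split; first by lra.
move=> n n2 d0 /andP[d0_gt0 _] [T [err stops]].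
have [d1 d1_gt0 d1P] := rateP n n2.
have n0 : (0 < n)%N by lia.
pose g b : 'I_n := if b then Ordinal n0 else Ordinal n2.
have gI : injective g by move=> [] [] // /(congr1 val).
(* From [K] on, [scale m.+1] lies below both [d0] and [d1], and [m >= 4] holds as the scale
   estimates require. *)
pose K := maxn 4 (maxn (Num.truncn d0^-1) (Num.truncn d1^-1)).
have half01 : 0 < (1 / 2 : R) < 1 by lra.
have null t := reject_prob_null g t half01 err.
apply: (@harmonic_increments_unbounded R (fun m => coin_prob (two_coins (1 / 2) (1 / 2))
  (rejects_by T g (scale_time (R := R) m))) (1 / 8) (1 / 16) K) => // m Km.
have m3 : (3 < m)%N by rewrite /K in Km; lia.
have [m0 m1 m13] : [/\ 1 < m, 1 < m.+1 & 3 < m.+1]%N by split; lia.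
have m4 : 4 <= m%:R :> R by rewrite ler_nat.
have [Kd0 Kd1] : (Num.truncn d0^-1 <= m)%N /\ (Num.truncn d1^-1 <= m)%N.
  by rewrite /K in Km; split; lia.
have small (d : R) : 0 < d -> (Num.truncn d^-1 <= m)%N -> scale m.+1 < d.
  move=> dpos; rewrite truncn_le_nat => dm.
  apply: le_lt_trans (scale_le_inv (ltn0Sn _)) _.
  by rewrite invf_plt ?posrE.
have e_gt0 : 0 < scale m.+1 :> R by exact: expR_gt0.
have e_d0 : scale m.+1 < d0 by apply: small.
have e_d1 : scale m.+1 < d1 by apply: small.
have e_half : scale m.+1 < 1 / 2 :> R.
  apply: le_lt_trans (scale_le_inv (ltn0Sn _)) _.
  by rewrite invf_plt ?posrE ?ltr0n // -natr1; lra.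
set e := scale m.+1 in e_gt0 e_d0 e_d1 e_half *.
have q01 : 0 < 1 / 2 + e < 1 by lra.
have p01' : 0 <= (1 / 2 : R) <= 1 by lra.
have q01' : 0 <= 1 / 2 + e <= 1 by lra.
have [D1 D1E] := coin_distr g p01'.
have [D2 D2E] := coin_distr g q01'.
have TVe : TV D1 D2 = e.
  rewrite (TV_coin_distr gI D1E D2E) -normrN ger0_norm; lra.
have D12 : D1 <> D2.
  move=> D12; move: TVe; rewrite D12 /TV big1 => [|i _]; last by rewrite subrr normr0.
  lra.
have := stops D1 D2 D12; rewrite TVe => /(_ e_d0) stop.
have e01 : 0 < e < d1 by lra.
have /andP[r0 rL] := d1P e e01.
have /andP[tb _] := scale_time_bound (R := R) m1.
have alt : 15 / 16 <= coin_prob (two_coins (1 / 2) (1 / 2 + e))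
    (rejects_by T g (scale_time (R := R) m.+1)).
  apply: (reject_prob_alternative half01 q01 D1E D2E _ _ stop); first lra.
  by apply: le_trans tb; rewrite -loglog_scale // ler_pM2l //; lra.
have em : 0 < e < 1 / 2 by lra.
have sm : (scale_time (R := R) m <= scale_time (R := R) m.+1)%N by exact: scale_time_mono.
(* The events are rejection by the times of scales [m] and [m.+1], compared under the alternative of
   scale [m.+1]. *)
have := new_mass_lower_bound em (@prefix_event_rejects_by n T g _)
  (@prefix_event_rejects_by n T g _) sm (fun u => @rejects_by_mono n T g _ _ u sm)
  (scale_next_time m3) (null _) alt.
apply: le_trans.
have -> : 1 / 8 / m.+1%:R = 1 / 4 * (1 / 2 / m.+1%:R) :> R.
  by move: (m.+1%:R^-1 : R) => y; lra.
by rewrite ler_wpM2l ?scale_time_mass //; lra.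
Qed.

(** * Comparison of the three rates for small [d] *)

(** The threshold [expR (- expR A)] is the point where [loglog] equals [A]; [d1 <= 1] serves to
    compare powers of [d]. *)
Lemma loglog_large (R : realType) (A : R) : 0 <= A -> exists2 d1 : R, 0 < d1 <= 1 &
  forall d, 0 < d < d1 -> A <= loglog d.
Proof.
move=> A0; exists (expR (- expR A)).
  by rewrite expR_gt0 -[X in _ <= X]expR0 ler_expR oppr_le0 expR_ge0.
move=> d /andP[d0 dlt]; rewrite /loglog.
have ineq : expR A <= ln d^-1.
  rewrite lnV ?posrE // lerNr -[leRHS]expRK ler_ln ?posrE ?expR_gt0 //; exact: ltW.
rewrite -[leLHS]expRK ler_ln ?posrE ?expR_gt0 //.
exact: lt_le_trans (expR_gt0 _) ineq.
Qed.

(** A weighted geometric mean does not exceed the larger of its two arguments. *)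
Lemma powR_mul_le (R : realType) (x y a b : R) :
  0 <= x -> x <= y -> 0 < a -> 0 < b -> a + b = 1 -> x `^ a * y `^ b <= y.
Proof.
move=> x0 xy a0 b0 ab; have y0 := le_trans x0 xy.
rewrite -[leRHS]powRr1 // -ab powRD; last by rewrite ab oner_eq0.
by rewrite ler_wpM2r ?powR_ge0 // ge0_ler_powR ?nnegrE // ltW.
Qed.

Unset Implicit Arguments.

Theorem theorem10 (R : realType) :
  closeness_lower_bound
    (fun (n : nat) (d : R) =>
       n%:R `^ (1 / 2) * loglog d `^ (1 / 2) / d ^+ 2) /\
  closeness_lower_bound
    (fun (n : nat) (d : R) => loglog d / d ^+ 2) /\
  closeness_lower_bound
    (fun (n : nat) (d : R) =>
       n%:R `^ (2 / 3) * loglog d `^ (1 / 3) / d `^ (4 / 3)).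
Proof.
split; [|split]; apply: closeness_lower_bound_loglog => n _;
  (* Taking [A = n] gives [n <= loglog d], so the powers of [n] are absorbed by those of
     [loglog d]. *)
  have [d1 /andP[d1_gt0 d1_le1] d1P] := loglog_large (ler0n R n);
  exists d1 => // d dP; have nL := d1P d dP; case/andP: dP => d_gt0 d_lt;
  have d_ge0 := ltW d_gt0; have n_ge0 : 0 <= n%:R :> R by [].
- rewrite divr_ge0 ?mulr_ge0 ?powR_ge0 ?sqr_ge0 //=.
  rewrite ler_wpM2r ?invr_ge0 ?sqr_ge0 //; apply: powR_mul_le => //; lra.
- by rewrite /= lexx andbT divr_ge0 ?exprn_ge0 // (le_trans _ nL).
rewrite divr_ge0 ?mulr_ge0 ?powR_ge0 //=.
apply: ler_pM; rewrite ?mulr_ge0 ?invr_ge0 ?powR_ge0 //.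
  by apply: powR_mul_le => //; lra.
(* Since [d <= 1] and [4/3 <= 2], the power [d ^+ 2] is the smaller one. *)
rewrite lef_pV2 ?posrE ?powR_gt0 ?exprn_gt0 //.
rewrite -powR_mulrn //; apply: ger_powR; last lra.
by rewrite d_gt0 (le_trans (ltW d_lt)).
Qed.
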